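(* The Banach space $\mathfrak X$ is $c_0$-saturated, that is, every closed infinite dimensional subspace of $\mathfrak X$ contains an isomorphic copy of $c_0$.
   Context: Scalars are real. $c_{00}(\omega_1)$ is the space of finitely supported functions $\omega_1\to\mathbb R$, with canonical Hamel basis $(e_\alpha)_{\alpha<\omega_1}$; an element $\phi\in c_{00}(\omega_1)$ acts as a functional by $\phi(x)=\sum_\alpha \phi(\alpha)x(\alpha)$, and $e_\alpha^*$ is $e_\alpha$ regarded as a functional. For sets of ordinals $s<t$ means that every element of $s$ is smaller than every element of $t$; for vectors $x<y$ means $\mathrm{supp}\,x<\mathrm{supp}\,y$. A block sequence is a $<$-increasing sequence (of finite sets, or of finitely supported vectors). The function $\varrho$. Fix $\varrho:[\omega_1]^2\to\omega$ such that for all $\alpha<\beta<\gamma<\omega_1$: $\varrho(\alpha,\gamma)\le\max\{\varrho(\alpha,\beta),\varrho(\beta,\gamma)\}$ and $\varrho(\alpha,\beta)\le\max\{\varrho(\alpha,\gamma),\varrho(\beta,\gamma)\}$; and $\{\alpha<\beta:\varrho(\alpha,\beta)\le n\}$ is finite for all $\beta<\omega_1$, $n\in\omega$. Put $\varrho(\alpha,\alpha)=0$. For $s,t\subseteq\omega_1$, $\varrho(s,t)=\min\{\varrho(\alpha,\beta):\alpha\in s,\beta\in t\}$. A sequence $(s_i)_i$ of sets is $p$-separated if $\varrho(s_i,s_j)\ge p$ for all $i\ne j$, and separated if it is $|\bigcup_i s_i|$-separated. These notions apply to vectors and functionals via their supports. For finite $F\subseteq\omega_1$ let $p_\varrho(F)=\max\{\varrho(\alpha,\beta):\alpha,\beta\in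 F\}$ and $\overline F^{\,p}=\{\alpha:\exists\beta\in F,\ \alpha\le\beta,\ \varrho(\alpha,\beta)\le p\}$ (a finite set). Parameters: $m_1=2$, $m_{j+1}=m_j^4$; $n_1=4$, $n_{j+1}=(4n_j)^{s_j}$ with $s_j=\log_2 m_{j+1}^3$. Coding. $Q_s(\omega_1)$ is the set of finite sequences $\Phi=(\phi_1,w_1,p_1,\dots,\phi_d,w_d,p_d)$ with $\phi_1<\dots<\phi_d$ nonzero elements of $c_{00}(\omega_1)$ with rational values, $(w_i)$ and $(p_i)$ strictly increasing sequences of positive integers, and $p_i\ge p_\varrho(\bigcup_{k\le i}\mathrm{supp}\,\phi_k)$ for all $i\le d$. $Q_s$ is the (countable) set of finite sequences of the same form with $\phi_i\in c_{00}(\omega)$, satisfying the same requirements except the last one. Fix a one-to-one $\sigma:Q_s\to\{2j: j\text{ odd}\}$ with $\sigma(\phi_1,w_1,p_1,\dots,\phi_d,w_d,p_d)>\max\{p_d^2,1/\varepsilon^2,\max\mathrm{supp}\,\phi_d\}$, where $\varepsilon=\min\{|\phi_k(\alpha)|:\alpha\in\mathrm{supp}\,\phi_k,\ k\le d\}$. For $\Phi\in Q_s(\omega_1)$ let $G=\overline{\bigcup_{i\le d}\mathrm{supp}\,\phi_i}^{\,p_d}$, let $\pi_G:\{1,\dots,|G|\}\to G$ be the increasing enumeration, let $\pi_G(\phi_k)(n)=\phi_k(\pi_G(n))$ for $1\le n\le|G|$ and $0$ otherwise, and set $\sigma_\varrho(\Phi)=\sigma(\pi_G(\phi_1),w_1,p_1,\dots,\pi_G(\phi_d),w_d,p_d)$.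 Norming set. $K$ is the minimal subset of $c_{00}(\omega_1)$ such that: (i) $K$ contains all $e_\gamma^*$, is symmetric, and is closed under restriction to intervals of $\omega_1$; (ii) for every $j\geq 1$ and every separated block sequence $(\phi_i)_{i=1}^d\subseteq K$ with $d\le n_{2j}$, $\frac1{m_{2j}}\sum_{i=1}^d\phi_i\in K$; (iii) for every $j\ge1$ and every separated $(2j+1)$-special sequence $(\phi_i)_{i=1}^d\subseteq K$ with $d\le n_{2j+1}$, $\frac1{m_{2j+1}}\sum_{i=1}^d\phi_i\in K$; (iv) $K$ is closed under rational convex combinations. A functional of the form given in (ii) or (iii) with factor $1/m_j$ is said to have weight $w(\phi)=m_j$ (and to be of type I). A block sequence $(\phi_1,\dots,\phi_d)$ in $K$ is $(2j+1)$-special if each $\phi_k$ has a weight $w(\phi_k)=m_{2j_k}$, with $j_1$ even and $m_{2j_1}>n_{2j+1}^2$, and there are integers $p_1<\dots<p_{d-1}$ such that for all $1\le i<d$, $\Phi_i=(\phi_1,w(\phi_1),p_1,\dots,\phi_i,w(\phi_i),p_i)\in Q_s(\omega_1)$ and $w(\phi_{i+1})=m_{\sigma_\varrho(\Phi_i)}$. $\mathfrak X$ is the completion of $c_{00}(\omega_1)$ under the norm $\|x\|=\sup\{\phi(x):\phi\in K\}$. *)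

(* Defs.v *)
From HB Require Import structures.
From mathcomp Require Import all_boot all_order all_algebra finmap.
From mathcomp Require Import all_classical all_reals all_analysis.
From mathcomp Require monalg.
(* The notations of monalg cannot be loaded together with those of
   mathcomp-analysis, but its instances are needed to make c00 an lmodType. *)
Export -(notations) monalg.

Set Implicit Arguments.
Unset Strict Implicit.
Unset Printing Implicit Defensive.

Import Order.TTheory GRing.Theory Num.Theory numFieldNormedType.Exports.

Local Open Scope fset_scope.
Local Open Scope classical_set_scope.
Local Open Scope ring_scope.

(* Characterizes the order type omega_1: an uncountable well-order all of whose
   proper initial segments are countable. *)
Record is_omega1 (d : Order.disp_t) (W : orderType d) : Prop := {
  omega1_wf : well_founded (fun a b : W => (a < b)%O) ;
  omega1_segment : forall a : W, countable [set b : W | (b < a)%O] ;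
  omega1_uncountable : ~ countable [set: W]
}.

(* Finitely supported functions T -> R: [msupp phi] is the support of [phi],
   [mcoeff a phi] its value at [a], and [mkmalgU a x] is x * e_a. *)
Notation c00 R T := (malg T R).

Section C00.
Context (R : realType) (d : Order.disp_t) (T : orderType d).
Implicit Types (phi x : c00 R T) (s : seq (c00 R T)).

Definition pairing phi x : R :=
  \sum_(a <- msupp phi) mcoeff a phi * mcoeff a x.

(* Every order-convex subset of a well-order is of the form [set` i]. *)
Definition restriction (i : interval T) phi : c00 R T :=
  \sum_(a <- msupp phi | a \in i) mkmalgU a (mcoeff a phi).

Definition rational_valued phi : Prop :=
  forall a, exists q : rat, mcoeff a phi = ratr q.

Definition supp_union s : {fset T} := \bigcup_(phi <- s) msupp phi.

Definition block s : bool :=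
  pairwise (fun phi psi => allrel <%O (msupp phi) (msupp psi)) s.

End C00.

Section Rho.
Context (d : Order.disp_t) (W : orderType d).
Implicit Types (rho : W -> W -> nat) (F : {fset W}).

(* rho is a function on unordered pairs, extended by 0 to the diagonal. *)
Record rho_function rho : Prop := {
  rho_sym : forall a b, rho a b = rho b a ;
  rho_diag : forall a, rho a a = 0%N ;
  rho_ultra1 : forall a b c, (a < b < c)%O ->
    (rho a c <= maxn (rho a b) (rho b c))%N ;
  rho_ultra2 : forall a b c, (a < b < c)%O ->
    (rho a b <= maxn (rho a c) (rho b c))%N ;
  rho_finite : forall b n, finite_set [set a | (a < b)%O && (rho a b <= n)%N]
}.

Definition p_rho rho F : nat := (\max_(a <- F) \max_(b <- F) rho a b)%N.

Definition rho_closure rho (p : nat) F : {fset W} :=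
  fset_set [set a | exists2 b, b \in F & (a <= b)%O && (rho a b <= p)%N].

(* The inner condition says p <= min {rho a b}, the minimum over the empty set
   being +oo; i < j suffices because rho is symmetric. *)
Definition p_separated rho (p : nat) (s : seq {fset W}) : bool :=
  pairwise (fun F G : {fset W} => allrel (fun a b => (p <= rho a b)%N) F G) s.

Definition rho_separated (R : realType) rho (s : seq (c00 R W)) : bool :=
  p_separated rho #|` supp_union s| [seq msupp phi | phi <- s].

End Rho.

(* m_j, s_j and n_j are indexed by j >= 1; the values at j = 0 are irrelevant.
   m_j is a power of 2, so that trunc_log is an exact logarithm in s_j. *)
Definition m_ (j : nat) : nat := iter j.-1 (fun x => x ^ 4)%N 2%N.

Definition s_ (j : nat) : nat := trunc_log 2 (m_ j.+1 ^ 3)%N.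

(* nS_ i is n_(i+1). *)
Fixpoint nS_ (i : nat) : nat :=
  if i is i'.+1 then ((4 * nS_ i') ^ s_ i)%N else 4%N.

Definition n_ (j : nat) : nat := nS_ j.-1.

(* An entry ((phi, w), p) of a coded sequence. *)
Notation entry R T := (c00 R T * nat * nat)%type.

Section Coding.
Context (R : realType).

Definition last_p (T : choiceType) (Phi : seq (entry R T)) : nat :=
  last 0%N [seq x.2 | x <- Phi].

Definition last_phi (T : choiceType) (Phi : seq (entry R T)) : c00 R T :=
  last 0 [seq x.1.1 | x <- Phi].

Record Qs_common (d : Order.disp_t) (T : orderType d)
    (Phi : seq (entry R T)) : Prop := {
  Qs_nonempty : Phi != [::] ;
  Qs_nonzero : forall x, x \in Phi -> x.1.1 != 0 ;
  Qs_rational : forall x, x \in Phi -> rational_valued x.1.1 ;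
  Qs_block : block [seq x.1.1 | x <- Phi] ;
  Qs_w_gt0 : forall x, x \in Phi -> (0 < x.1.2)%N ;
  Qs_w_incr : sorted ltn [seq x.1.2 | x <- Phi] ;
  Qs_p_gt0 : forall x, x \in Phi -> (0 < x.2)%N ;
  Qs_p_incr : sorted ltn [seq x.2 | x <- Phi]
}.

Definition Qs (Phi : seq (entry R nat)) : Prop := Qs_common Phi.

Definition min_coeff (Phi : seq (entry R nat)) : R :=
  inf [set r : R | exists2 x, x \in Phi &
                   exists2 n, n \in msupp x.1.1 & r = `|mcoeff n x.1.1|].

Record coding (sigma : seq (entry R nat) -> nat) : Prop := {
  coding_range : forall Phi, Qs Phi -> exists2 j, odd j & sigma Phi = (2 * j)%N ;
  coding_inj : forall Phi Psi, Qs Phi -> Qs Psi -> sigma Phi = sigma Psi ->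
    Phi = Psi ;
  coding_gt_p : forall Phi, Qs Phi -> (last_p Phi ^ 2 < sigma Phi)%N ;
  coding_gt_eps : forall Phi, Qs Phi ->
    1 / min_coeff Phi ^+ 2 < (sigma Phi)%:R ;
  coding_gt_supp : forall Phi, Qs Phi ->
    (\max_(n <- msupp (last_phi Phi)) n < sigma Phi)%N
}.

Context (d : Order.disp_t) (W : orderType d) (rho : W -> W -> nat).

Definition Qs_omega1 (Phi : seq (entry R W)) : Prop :=
  Qs_common Phi /\
  forall i, (i < size Phi)%N ->
    (p_rho rho (supp_union [seq x.1.1 | x <- take i.+1 Phi])
       <= nth 0%N [seq x.2 | x <- Phi] i)%N.

(* pi_G(phi): its value at n, 1 <= n <= |G|, is that of phi at the n-th element
   of G. *)
Definition collapse (G : {fset W}) (phi : c00 R W) : c00 R nat :=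
  \sum_(1 <= n < #|` G|.+1)
    mkmalgU n (nth 0 [seq mcoeff a phi | a <- sort <=%O G] n.-1).

Definition sigma_rho (sigma : seq (entry R nat) -> nat)
    (Phi : seq (entry R W)) : nat :=
  let G := rho_closure rho (last_p Phi) (supp_union [seq x.1.1 | x <- Phi]) in
  sigma [seq (collapse G x.1.1, x.1.2, x.2) | x <- Phi].

End Coding.

Section NormingSet.
Context (R : realType) (d : Order.disp_t) (W : orderType d).
Context (rho : W -> W -> nat) (sigma : seq (entry R nat) -> nat).
Implicit Types (A : set (c00 R W)) (phi : c00 R W) (s : seq (c00 R W)).

Definition weighted_sum (j : nat) s : c00 R W :=
  (m_ j)%:R^-1 *: \sum_(phi <- s) phi.

Definition separated_block_in A s : Prop :=
  [/\ s != [::], (forall phi, phi \in s -> A phi), block s & rho_separated rho s].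

(* w(phi) = m_(2j) relative to A; as j |-> m_ j is one-to-one on j >= 1, the
   functionals with a weight of even index are those of form (ii). *)
Definition even_weight A (j : nat) phi : Prop :=
  (1 <= j)%N /\
  exists s, [/\ separated_block_in A s, (size s <= n_ (2 * j))%N &
                phi = weighted_sum (2 * j) s].

(* Positions in s are counted from 0: [jj k] and [p k] are the j_(k+1) and
   p_(k+1) of the definition, [Phi i] is Phi_i, and the functional following
   Phi_i is [nth 0 s i]. *)
Definition special A (j : nat) s : Prop :=
  [/\ s != [::], (forall phi, phi \in s -> A phi), block s &
  exists jj p : nat -> nat,
    let w k := m_ (2 * jj k) in
    let Phi i := mkseq (fun k => (nth 0 s k, w k, p k)) i in
    [/\ (forall k, (k < size s)%N -> even_weight A (jj k) (nth 0 s k)),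
        ~~ odd (jj 0%N) /\ (n_ (2 * j + 1) ^ 2 < w 0)%N,
        (forall i, (i.+1 < (size s).-1)%N -> (p i < p i.+1)%N) &
        (forall i, (1 <= i < size s)%N ->
           Qs_omega1 rho (Phi i) /\ w i = m_ (sigma_rho rho sigma (Phi i)))]].

Record norming_closed A : Prop := {
  norming_unit : forall a, A (mkmalgU a 1) ;
  norming_sym : forall phi, A phi -> A (- phi) ;
  norming_restr : forall (i : interval W) phi, A phi -> A (restriction i phi) ;
  norming_even : forall j s, (1 <= j)%N -> separated_block_in A s ->
    (size s <= n_ (2 * j))%N -> A (weighted_sum (2 * j) s) ;
  norming_odd : forall j s, (1 <= j)%N -> separated_block_in A s ->
    special A j s -> (size s <= n_ (2 * j + 1))%N ->
    A (weighted_sum (2 * j + 1) s) ;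
  norming_convex : forall t : seq (rat * c00 R W),
    (forall x, x \in t -> 0 <= x.1 /\ A x.2) -> \sum_(x <- t) x.1 = 1 ->
    A (\sum_(x <- t) ratr x.1 *: x.2)
}.

Definition norming_set : set (c00 R W) := \bigcap_(A in norming_closed) A.

Definition norm_K (x : c00 R W) : R := sup [set pairing phi x | phi in norming_set].

(* (X, J) is the completion of c00(omega_1) under norm_K; this determines X up
   to a unique isometric isomorphism. *)
Record is_completion (X : completeNormedModType R)
    (J : {linear c00 R W -> X}) : Prop := {
  completion_isometric : forall x, `|J x| = norm_K x ;
  completion_dense : dense (range J)
}.

End NormingSet.

Section Saturation.
Context (R : realType) (X : completeNormedModType R).
Implicit Types Y : set X.

Definition linear_subspace Y : Prop :=
  Y 0 /\ forall (a : R) u v, Y u -> Y v -> Y (a *: u + v).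

Definition infinite_dimensional Y : Prop :=
  ~ exists (n : nat) (v : 'I_n -> X), (forall i, Y (v i)) /\
      forall y, Y y -> exists c : 'I_n -> R, y = \sum_i c i *: v i.

Definition c0 : set (nat -> R) := [set u | u @ \oo --> (0 : R)].

Definition sup_norm (u : nat -> R) : R := sup (range (fun n => `|u n|)).

(* T restricted to c0 is a linear isomorphism onto a subspace of Y; the values
   of T outside c0 are irrelevant. *)
Definition contains_c0 Y : Prop :=
  exists T : (nat -> R) -> X,
    [/\ (forall (a : R) u v, c0 u -> c0 v ->
           T (fun n => a * u n + v n) = a *: T u + T v),
        (forall u, c0 u -> Y (T u)) &
        exists b C : R, [/\ 0 < b, 0 < C &
          forall u, c0 u -> b * sup_norm u <= `|T u| <= C * sup_norm u]].

Definition c0_saturated : Prop :=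
  forall Y, closed Y -> linear_subspace Y -> infinite_dimensional Y -> contains_c0 Y.

End Saturation.

Arguments c0_saturated {R} X.

(* Main.v *)
Require Import Defs.
From HB Require Import structures.
From mathcomp Require Import all_boot all_order all_algebra finmap.
From mathcomp Require Import all_classical all_reals all_analysis.
From mathcomp Require Import zify ring lra.

Set Implicit Arguments.
Unset Strict Implicit.
Unset Printing Implicit Defensive.

Import Order.TTheory GRing.Theory Num.Theory numFieldNormedType.Exports.

(** Suppose first that the closed subspace Y contains unit vectors y_n with
    arbitrarily small sup norm (on finitely supported approximants x_n), chosen
    with |x_n|_oo tiny compared with p_rho of the union of the earlier supports.
    Let phi = (1/m) sum phi_i in K be separated, and let n be the first index for
    which two different phi_i meet supp x_0 u ... u supp x_n.  Before n a single
    phi_i acts; after n, separation gives |supp phi| <= p_rho (supp x_0 u ... u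
    supp x_n), so phi(x_k) is negligible.  As m >= 16, induction over K yields
    sum_k |phi(x_k)| <= 11/8, an upper c_0 estimate with a constant smaller than 2.
    That constant also gives the lower estimate: if |c_k| is maximal and v is
    sum_l c_l y_l, then 2 c_k y_k = v + v', where v' has coefficients of the same
    moduli as v.
    Otherwise the sup norm is equivalent to the norm on Y; unit vectors of Y in
    the kernels of more and more coordinate functionals have disjointly supported
    approximants, and such a sequence spans c_0. *)

Local Open Scope fset_scope.
Local Open Scope classical_set_scope.
Local Open Scope ring_scope.

(** * Pairing and interval restriction on finitely supported functions *)

Section FinitelySupported.
Context (R : realType) (d : Order.disp_t) (T : orderType d).
Implicit Types (phi x : c00 R T) (s : seq (c00 R T)) (i : interval T).

(** Lets functionals with different supports be summed over one common finite set, as additivity of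
    [pairing] requires. *)
Lemma pairing_widen (D : {fset T}) phi x :
  {subset msupp phi <= D} ->
  pairing phi x = \sum_(a <- D) mcoeff a phi * mcoeff a x.
Proof.
move=> sD; rewrite /pairing; apply: big_fset_incl => [|a _ a_phi].
  exact/fsubsetP.
by rewrite mcoeff_outdom // mul0r.
Qed.

Lemma pairingD phi psi x : pairing (phi + psi) x = pairing phi x + pairing psi x.
Proof.
pose D := (msupp phi `|` msupp psi)%fset.
have sD a : a \in msupp (phi + psi) -> a \in D by apply/fsubsetP/msuppD_le.
rewrite (pairing_widen x sD) (@pairing_widen D phi) ?(@pairing_widen D psi).
- by rewrite -big_split; apply: eq_bigr => a _; rewrite mcoeffD mulrDl.
- by move=> a; rewrite inE orbC => ->.
- by move=> a; rewrite inE => ->.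
Qed.

Lemma pairingZ (c : R) phi x : pairing (c *: phi) x = c * pairing phi x.
Proof.
have sD : {subset msupp (c *: phi) <= msupp phi}.
  by apply/fsubsetP/monalg.msuppZ_le.
rewrite (pairing_widen x sD) /pairing mulr_sumr.
by apply: eq_bigr => a _; rewrite mcoeffZ mulrA.
Qed.

Lemma pairingN phi x : pairing (- phi) x = - pairing phi x.
Proof. by rewrite -scaleN1r pairingZ mulN1r. Qed.

Lemma pairing0 x : pairing 0 x = 0.
Proof. by rewrite -(scale0r 0) pairingZ mul0r. Qed.

Lemma pairing_sum (I : Type) (r : seq I) (F : I -> c00 R T) x :
  pairing (\sum_(k <- r) F k) x = \sum_(k <- r) pairing (F k) x.
Proof.
by apply: (big_morph (fun phi => pairing phi x)) => [phi psi|];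
  rewrite (pairingD, pairing0).
Qed.

Lemma pairing_sumr (I : Type) (r : seq I) (c : I -> R) (F : I -> c00 R T) phi :
  pairing phi (\sum_(k <- r) c k *: F k) = \sum_(k <- r) c k * pairing phi (F k).
Proof.
rewrite /pairing (eq_bigr (fun a =>
    \sum_(k <- r) c k * (mcoeff a phi * mcoeff a (F k)))) => [|a _].
  by rewrite exchange_big; apply: eq_bigr => k _; rewrite -mulr_sumr.
rewrite raddf_sum /= mulr_sumr; apply: eq_bigr => k _.
by rewrite mcoeffZ mulrCA.
Qed.

Lemma pairing_unit a x : pairing (mkmalgU a 1) x = mcoeff a x.
Proof.
rewrite (@pairing_widen [fset a]); last by apply/fsubsetP; exact: msuppU_le.
by rewrite big_seq_fset1 mcoeffUU mul1r.
Qed.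

Lemma mcoeff_restriction i phi a :
  mcoeff a (restriction i phi) = if a \in i then mcoeff a phi else 0.
Proof.
rewrite /restriction raddf_sum /= big_mkcond /=.
under eq_bigr => b _ do rewrite mcoeffU.
have [a_phi|a_phi] := boolP (a \in msupp phi); last first.
  rewrite mcoeff_outdom // if_same big_seq big1 // => b b_phi.
  have /negPf-> : b != a by apply: contraNneq a_phi => <-.
  by rewrite mulr0n if_same.
rewrite (big_fsetD1 a) //= eqxx big_seq big1 ?addr0 // => b.
by rewrite !inE => /andP[/negPf-> _]; rewrite mulr0n if_same.
Qed.

Lemma msupp_restriction i phi : {subset msupp (restriction i phi) <= msupp phi}.
Proof.
move=> a; rewrite -!mcoeff_neq0 mcoeff_restriction.
by case: ifP => //; rewrite eqxx.
Qed.

Lemma pairing_restriction i phi x :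
  pairing (restriction i phi) x = pairing phi (restriction i x).
Proof.
rewrite (pairing_widen x (@msupp_restriction i phi)).
apply: eq_bigr => a _; rewrite !mcoeff_restriction.
by case: ifP; rewrite ?mul0r ?mulr0.
Qed.

Lemma restriction_restriction i j x :
  restriction i (restriction j x) = restriction (Order.meet i j) x.
Proof.
apply/malgP => a; rewrite !mcoeff_restriction in_itvI.
by case: (a \in i).
Qed.

Lemma restriction_full x : restriction `]-oo, +oo[ x = x.
Proof. by apply/malgP => a; rewrite mcoeff_restriction. Qed.

Lemma pairing_disjoint phi x :
  (forall a, a \in msupp phi -> a \notin msupp x) -> pairing phi x = 0.
Proof.
move=> dis; rewrite /pairing big_seq big1 // => a /dis a_x.
by rewrite (mcoeff_outdom a_x) mulr0.
Qed.

Lemma pairing_sup_bound phi x (D : {fset T}) (c e : R) :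
  {subset msupp phi <= D} -> 0 <= c -> (forall a, `|mcoeff a phi| <= c) ->
  (forall a, `|mcoeff a x| <= e) -> `|pairing phi x| <= #|` D|%:R * (c * e).
Proof.
move=> sD c0 phic xe; rewrite (pairing_widen x sD).
apply: le_trans (ler_norm_sum _ _ _) _.
rewrite mulr_natl -sum1_size -sumrMnr [leRHS]big_seq big_seq.
by apply: ler_sum => a _; rewrite normrM mulr1n ler_pM.
Qed.

Lemma in_supp_union s phi a : phi \in s -> a \in msupp phi -> a \in supp_union s.
Proof. by move=> phi_s a_phi; apply/bigfcupP; exists phi; rewrite ?phi_s. Qed.

Lemma msupp_weighted_sum (j : nat) s : {subset msupp (weighted_sum j s) <= supp_union s}.
Proof.
move=> a; rewrite -mcoeff_neq0 mcoeffZ mulf_eq0 negb_or => /andP[_].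
rewrite raddf_sum /= => /eqP nz.
have [//|a_s] := boolP (a \in supp_union s); exfalso; apply: nz.
rewrite big_seq big1 // => phi phi_s; apply/mcoeff_outdom.
by apply: contra a_s; apply: in_supp_union.
Qed.

End FinitelySupported.

(** * The norming set: induction principle, coefficient bounds and the norm *)

Lemma m_ge16 j : (2 <= j)%N -> (16 <= m_ j)%N.
Proof.
case: j => [//|[//|j] _]; rewrite /m_ /= (@leq_exp2r 2 _ 4) //.
elim: j => //= j IHj; apply: (leq_trans IHj).
by rewrite -[leqLHS]expn1 leq_pexp2l // (leq_trans _ IHj).
Qed.

Section NormingSetTheory.
Context (R : realType) (d : Order.disp_t) (W : orderType d).
Context (rho : W -> W -> nat) (sigma : seq (entry R nat) -> nat).
Implicit Types (A B : set (c00 R W)) (phi x : c00 R W) (s : seq (c00 R W)).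

Local Notation K := (norming_set rho sigma).

Lemma separated_block_in_sub A B s :
  A `<=` B -> separated_block_in rho A s -> separated_block_in rho B s.
Proof. by move=> AB [? As ? ?]; split => // phi /As /AB. Qed.

Lemma special_sub A B j s :
  A `<=` B -> special rho sigma A j s -> special rho sigma B j s.
Proof.
move=> AB [? As ? [jj [p [ew ? ? ?]]]]; split => //; first by move=> phi /As /AB.
exists jj, p; split => // k /ew[j1 [t [tA ? ?]]]; split => //.
by exists t; split => //; apply: separated_block_in_sub tA.
Qed.

Lemma norming_set_closed : norming_closed rho sigma K.
Proof.
have sub A : norming_closed rho sigma A -> K `<=` A by move=> ? phi; exact.
split.
- by move=> a A cA; apply: norming_unit cA _.
- by move=> phi Kphi A cA; apply: (norming_sym cA); exact: Kphi.
- by move=> i phi Kphi A cA; apply: (norming_restr cA); exact: Kphi.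
- move=> j s j1 Ks sz A cA; apply: (norming_even cA) => //.
  exact: separated_block_in_sub (sub _ cA) Ks.
- move=> j s j1 Ks sp sz A cA; apply: (norming_odd cA) => //.
    exact: separated_block_in_sub (sub _ cA) Ks.
  exact: special_sub (sub _ cA) sp.
- move=> t Kt t1 A cA; apply: (norming_convex cA) => // y /Kt[? Ky].
  by split => //; apply: Ky.
Qed.

(** By minimality of [K], since [K] intersected with [P] is again closed. The even and the special
    odd operations merge into one case: of a special sequence only its separation is kept, and the
    weight indices [2 * j] and [2 * j + 1] are both at least 2. Membership of the weighted sum in
    [K] is handed to the induction step, which may thus use bounds valid on [K]. *)
Lemma norming_set_ind (P : c00 R W -> Prop) :
  (forall a, P (mkmalgU a 1)) ->
  (forall phi, P phi -> P (- phi)) ->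
  (forall i phi, P phi -> P (restriction i phi)) ->
  (forall j s, (2 <= j)%N -> separated_block_in rho (K `&` P) s ->
    K (weighted_sum j s) -> P (weighted_sum j s)) ->
  (forall t : seq (rat * c00 R W), (forall y, y \in t -> 0 <= y.1 /\ P y.2) ->
    \sum_(y <- t) y.1 = 1 -> P (\sum_(y <- t) ratr y.1 *: y.2)) ->
  K `<=` P.
Proof.
move=> Pe PN Pi Pw Pc; have cK := norming_set_closed.
have KPK : K `&` P `<=` K by move=> ? [].
suff cKP : norming_closed rho sigma (K `&` P) by move=> phi /(_ _ cKP)[].
split.
- by move=> a; split; [exact: norming_unit cK a|].
- by move=> phi [? ?]; split; [exact: norming_sym cK _ _|exact: PN].
- by move=> i phi [? ?]; split; [exact: norming_restr cK _ _ _|exact: Pi].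
- move=> j s j1 KPs sz.
  have Ks : K (weighted_sum (2 * j) s).
    by apply: (norming_even cK) => //; apply: separated_block_in_sub KPs.
  by split => //; apply: Pw => //; lia.
- move=> j s j1 KPs sp sz.
  have Ks : K (weighted_sum (2 * j + 1) s).
    apply: (norming_odd cK) => //; first exact: separated_block_in_sub KPs.
    exact: special_sub sp.
  by split => //; apply: Pw => //; lia.
- move=> t KPt t1; split; last by apply: Pc => // y /KPt[? []].
  by apply: (norming_convex cK) => // y /KPt[? []].
Qed.

Lemma convex_comb_le (I : eqType) (t : seq (rat * I)) (F : I -> R) (c : R) :
  (forall y, y \in t -> 0 <= y.1 /\ F y.2 <= c) -> \sum_(y <- t) y.1 = 1 ->
  \sum_(y <- t) ratr y.1 * F y.2 <= c.
Proof.
move=> tP t1; have -> : c = \sum_(y <- t) ratr y.1 * c.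
  by rewrite -mulr_suml -rmorph_sum /= t1 rmorph1 mul1r.
rewrite big_seq [leRHS]big_seq; apply: ler_sum => y /tP[? ?].
by rewrite ler_wpM2l // ler0q.
Qed.

Lemma norming_set_coeff_le1 phi a : K phi -> `|mcoeff a phi| <= 1.
Proof.
move: phi a; pose P phi := forall a, `|mcoeff a phi| <= 1.
suff: K `<=` P by move=> KP phi a /KP.
apply: norming_set_ind => [b a|phi Pphi a|i phi Pphi a|j s j2 [_ KPs bl _] _ a|t tP t1 a].
- by rewrite mcoeffU; case: eqP; rewrite ?mulr1n ?mulr0n ?normr1 ?normr0.
- by rewrite mcoeffN normrN.
- by rewrite mcoeff_restriction; case: ifP; rewrite ?normr0.
- rewrite mcoeffZ normrM normfV normr_nat raddf_sum /=.
  have m0 : (0 < m_ j)%N by rewrite (leq_trans _ (m_ge16 j2)).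
  rewrite mulrC ler_pdivrMr ?ltr0n // mul1r.
  apply: (@le_trans _ _ 1); last by rewrite ler1n.
  have {}KPs psi : psi \in s -> `|mcoeff a psi| <= 1 by move=> /KPs[].
  elim: s bl KPs => [|psi s IHs]; first by rewrite big_nil normr0.
  rewrite big_cons /block /= => /andP[/allP psi_s bl] Ps.
  (* Members of a block sequence have disjoint supports, so at most one of them contributes at
     [a]. *)
  have [a_psi|a_psi] := boolP (a \in msupp psi); last first.
    rewrite (mcoeff_outdom a_psi) add0r IHs // => phi phi_s.
    by apply: Ps; rewrite inE phi_s orbT.
  rewrite big_seq big1 ?addr0 ?Ps ?mem_head // => phi /psi_s /allrelP lt_psi.
  apply/mcoeff_outdom/negP => a_phi.
  by have := lt_psi _ _ a_psi a_phi; rewrite ltxx.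
- rewrite raddf_sum; apply: le_trans (ler_norm_sum _ _ _) _ => /=.
  under eq_big_seq => y /tP[y0 _].
    by rewrite mcoeffZ normrM [X in X * _]ger0_norm ?ler0q //; over.
  apply: (@convex_comb_le _ _ (fun phi => `|mcoeff a phi|)) => // y /tP[y0 Py].
  by split.
Qed.

(** Shows that the supremum defining [norm_K] runs over a bounded set, hence is a true least upper
    bound. *)
Lemma pairing_le_l1 phi x : K phi -> pairing phi x <= \sum_(a <- msupp x) `|mcoeff a x|.
Proof.
move=> Kphi; pose D := (msupp phi `|` msupp x)%fset.
have x_D : (msupp x `<=` D)%fset by apply: fsubsetUr.
rewrite (@pairing_widen _ _ _ D); last by move=> a; rewrite inE => ->.
rewrite (big_fset_incl _ x_D) => [|a _ a_x]; last by rewrite mcoeff_outdom ?normr0.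
apply: ler_sum => a _; apply: le_trans (ler_norm _) _.
by rewrite normrM ler_piMl // norming_set_coeff_le1.
Qed.

Lemma norming_set_abs phi x : K phi ->
  exists2 psi, K psi & `|pairing phi x| = pairing psi x.
Proof.
move=> Kphi; have [_|_] := ger0P (pairing phi x); first by exists phi.
exists (- phi); last by rewrite pairingN.
exact: (norming_sym norming_set_closed).
Qed.

Lemma pairing_le_norm_K phi x : K phi -> `|pairing phi x| <= norm_K rho sigma x.
Proof.
move=> /(norming_set_abs x)[psi Kpsi ->]; apply: ub_le_sup; last by exists psi.
by exists (\sum_(a <- msupp x) `|mcoeff a x|) => _ [phi' K' <-]; exact: pairing_le_l1.
Qed.

Lemma mcoeff_le_norm_K a x : `|mcoeff a x| <= norm_K rho sigma x.
Proof.
by rewrite -pairing_unit pairing_le_norm_K //; exact: norming_unit norming_set_closed _.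
Qed.

Lemma norm_K_le (c : R) x : 0 <= c -> (forall phi, K phi -> pairing phi x <= c) ->
  norm_K rho sigma x <= c.
Proof.
move=> c0 Kc; rewrite /norm_K; set S := [set _ | _ in _].
(* [sup] of the empty set is 0 by convention; this case uses [0 <= c]. *)
have [->|/set0P S0] := eqVneq S set0; first by rewrite sup0.
by apply: ge_sup => // _ [phi Kphi <-]; exact: Kc.
Qed.

Lemma norm_K_unit a : norm_K rho sigma (mkmalgU a (1 : R)) <= 1.
Proof.
apply: norm_K_le => // phi Kphi; apply: le_trans (pairing_le_l1 _ Kphi) _.
rewrite (big_fset_incl _ (@msuppU_le _ _ a 1)) => [|b _ b_a].
  by rewrite big_seq_fset1 mcoeffUU normr1.
by rewrite mcoeff_outdom ?normr0.
Qed.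

End NormingSetTheory.

(** * The upper estimate for vectors of rapidly decreasing sup norm *)

Section SmallSupNorm.
Context (R : realType) (d : Order.disp_t) (W : orderType d).
Context (rho : W -> W -> nat) (sigma : seq (entry R nat) -> nat).
Implicit Types (F : {fset W}) (phi : c00 R W) (s : seq (c00 R W)).

Local Notation K := (norming_set rho sigma).

Lemma rho_le_p_rho F a b : a \in F -> b \in F -> (rho a b <= p_rho rho F)%N.
Proof.
move=> aF bF; rewrite /p_rho.
apply: leq_trans (leq_bigmax_seq _ aF isT).
exact: (leq_bigmax_seq _ bF isT).
Qed.

(* If two members of a p-separated family meet F, then p <= p_rho F; otherwise
   at most one member acts on vectors supported in F. *)
Lemma p_separated_dichotomy p s F :
  p_separated rho p [seq msupp phi | phi <- s] ->
  (p <= p_rho rho F)%N \/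
  exists2 psi, psi \in 0 :: s & forall x, {subset msupp x <= F} ->
    pairing (\sum_(phi <- s) phi) x = pairing psi x.
Proof.
elim: s => [_|psi s IHs].
  (* The value 0 stands for the acting member when no member meets [F]. *)
  by right; exists 0; rewrite ?mem_head // => x _; rewrite big_nil.
rewrite /p_separated /= => /andP[/allP psi_s /IHs{}IHs].
have [/existsP[[a aF] /= a_psi]|] :=
    boolP [exists a : F, val a \in msupp psi]; last first.
  rewrite negb_exists => /forallP psiF.
  case: IHs => [|[psi' psi's E]]; [by left|right; exists psi'].
    by move: psi's; rewrite !inE => /orP[|] ->; rewrite ?orbT.
  move=> x xF; rewrite big_cons pairingD E // [X in X + _]pairing_disjoint ?add0r //.
  by move=> a a_psi; apply/negP => /xF aF; have := psiF [` aF]; rewrite a_psi.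
have [/hasP[phi phi_s /existsP[[b bF] /= b_phi]]|] :=
    boolP (has (fun phi => [exists b : F, val b \in msupp phi]) s).
  left; apply: leq_trans (rho_le_p_rho aF bF).
  by have /allrelP := psi_s _ (map_f _ phi_s); apply.
move=> /hasPn sF; right; exists psi; first by rewrite !inE eqxx orbT.
move=> x xF; rewrite big_cons pairingD pairing_sum big_seq [X in _ + X]big1 ?addr0 //.
move=> phi /sF; rewrite negb_exists => /forallP phiF.
apply: pairing_disjoint => b b_phi; apply/negP => /xF bF.
by have := phiF [` bF]; rewrite b_phi.
Qed.

Variables (x : nat -> c00 R W) (e : nat -> R).
Let F k := supp_union (mkseq x k).
Hypothesis e_ge0 : forall k, 0 <= e k.
Hypothesis x_norm : forall k, norm_K rho sigma (x k) <= 17 / 16.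
Hypothesis x_sup : forall k a, `|mcoeff a (x k)| <= e k / (p_rho rho (F k)).+1%:R.
Hypothesis e_sum : forall N, \sum_(k < N) e k <= 1 / 8.

Let e_ge k a : `|mcoeff a (x k)| <= e k.
Proof.
apply: le_trans (x_sup k a) _; rewrite ler_pdivrMr ?ltr0n // ler_peMr ?ler1n ?e_ge0 // ler1n.
Qed.

Lemma norming_set_sum_le phi N : K phi -> \sum_(k < N) `|pairing phi (x k)| <= 11 / 8.
Proof.
(* Quantifying over all intervals makes the property stable under restriction of [phi], which passes
   to the vectors. *)
pose P phi := forall i N, \sum_(k < N) `|pairing phi (restriction i (x k))| <= 11 / 8.
suff KP : K `<=` P.
  move=> /KP /(_ `]-oo, +oo[ N).
  by under eq_bigr => k _ do rewrite restriction_full.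
apply: norming_set_ind => {phi N} [a i N|phi Pphi i N|j phi Pphi i N|j s j2 sP Ks i N|t tP t1 i N].
- apply: (@le_trans _ _ (\sum_(k < N) e k)); last by apply: le_trans (e_sum N) _; lra.
  apply: ler_sum => k _; rewrite pairing_unit mcoeff_restriction.
  by case: ifP => _; rewrite ?normr0 ?e_ge // (le_trans _ (e_ge k a)).
- by under eq_bigr => k _ do rewrite pairingN normrN.
- under eq_bigr => k _ do rewrite pairing_restriction restriction_restriction.
  exact: Pphi.
- have [_ KPs _ sep] := sP; set phi := weighted_sum j s.
  have m16 : (m_ j)%:R^-1 <= 16^-1 :> R.
    by rewrite lef_pV2 ?posrE ?ltr0n ?(ler_nat _ 16) ?(leq_trans _ (m_ge16 j2)) // m_ge16.
  have xF k l : (k < l)%N -> {subset msupp (restriction i (x k)) <= F l}.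
    move=> kl a /msupp_restriction; apply: in_supp_union.
    by rewrite map_f // mem_iota.
  have term k : `|pairing phi (restriction i (x k))| <= 17 / 16.
    rewrite -pairing_restriction; apply: le_trans (x_norm k).
    apply: pairing_le_norm_K.
    by apply: (norming_restr (norming_set_closed rho sigma)).
  (* While the separation exceeds [p_rho] of the supports so far, one member of [s] acts alone; its
     induction bound 11/8 is divided by the weight, which is at least 16. *)
  have single n : ~~ (#|` supp_union s| <= p_rho rho (F n))%N ->
      \sum_(k < n) `|pairing phi (restriction i (x k))| <= 11 / 8 / 16.
    move=> sF; have [|[psi psi_s E]] := p_separated_dichotomy (F n) sep.
      by rewrite (negPf sF).
    under eq_bigr => k _ do
      rewrite pairingZ (E _ (xF _ _ (ltn_ord k))) normrM normfV normr_nat.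
    rewrite -mulr_sumr mulrC; apply: ler_pM => //; first exact: sumr_ge0.
    move: psi_s; rewrite inE => /predU1P[->|/KPs[_ /(_ i n)] //].
    by rewrite big1 // => k _; rewrite pairing0 normr0.
  (* The three summands bound the terms before the critical index, the term at that index, and the
     later ones. With [e_sum] the total is at most 11/128 + 17/16 + 1/8 = 163/128, below 11/8. *)
  have step n : \sum_(k < n) `|pairing phi (restriction i (x k))| <=
      11 / 8 / 16 + 17 / 16 + \sum_(k < n) e k.
    elim: n => [|n IHn]; first by rewrite !big_ord0; lra.
    rewrite !big_ord_recr /=.
    (* If the separation still exceeds [p_rho rho (F n)], [single] bounds the first [n] terms afresh
       and term [n] costs 17/16. Otherwise the support of [phi] has at most [p_rho rho (F n)]
       points, so term [n] costs only [e n]. *)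
    have [sF|/single ?] := boolP (#|` supp_union s| <= p_rho rho (F n))%N; last first.
      have : 0 <= \sum_(k < n) e k by apply: sumr_ge0.
      by have := term n; have := e_ge0 n; lra.
    rewrite addrA; apply: lerD IHn _.
    apply: le_trans (pairing_sup_bound (@msupp_weighted_sum _ _ _ j s) ler01 _ _) _.
    + by move=> a; apply: norming_set_coeff_le1 Ks.
    + move=> a; rewrite mcoeff_restriction; case: ifP => _; first exact: x_sup.
      by rewrite normr0 divr_ge0.
    + rewrite mul1r mulrCA ler_piMr // ler_pdivrMr ?ltr0n // mul1r ler_nat.
      exact: leq_trans sF _.
  by apply: le_trans (step N) _; have := e_sum N; lra.
- under eq_bigr => k _ do rewrite pairing_sum.
  apply: (@le_trans _ _
    (\sum_(y <- t) ratr y.1 * \sum_(k < N) `|pairing y.2 (restriction i (x k))|)).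
    under [leRHS]eq_bigr => y _ do rewrite mulr_sumr.
    rewrite [leRHS]exchange_big; apply: ler_sum => k _.
    apply: le_trans (ler_norm_sum _ _ _) _ => /=.
    rewrite big_seq [leRHS]big_seq; apply: ler_sum => y /tP[y0 _].
    by rewrite pairingZ normrM [X in X * _]ger0_norm ?ler0q.
  apply: (@convex_comb_le _ _ _
    (fun phi => \sum_(k < N) `|pairing phi (restriction i (x k))|)) => // y /tP[y0 Py].
  by split.
Qed.

Lemma norm_K_sum_le (c : nat -> R) (M : R) N : 0 <= M ->
  (forall k, (k < N)%N -> `|c k| <= M) ->
  norm_K rho sigma (\sum_(k < N) c k *: x k) <= M * (11 / 8).
Proof.
move=> M0 cM; apply: norm_K_le => [|phi Kphi]; first by apply: mulr_ge0.
rewrite pairing_sumr; apply: le_trans (ler_norm _) _.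
apply: le_trans (ler_norm_sum _ _ _) _.
apply: le_trans (ler_wpM2l M0 (norming_set_sum_le N Kphi)).
rewrite mulr_sumr; apply: ler_sum => k _; rewrite normrM.
by apply: ler_wpM2r => //; exact: cM.
Qed.

End SmallSupNorm.

(** * A criterion for containing a copy of c_0 *)

Section C0Sequences.
Context (R : realType).
Implicit Types u : nat -> R.

Lemma c0_small u (e : R) : c0 u -> 0 < e ->
  exists N, forall k, (N <= k)%N -> `|u k| < e.
Proof. by move=> /cvgr0Pnorm_lt cu /cu[N _ NP]; exists N => k /NP. Qed.

Lemma le_sup_norm u n : c0 u -> `|u n| <= sup_norm u.
Proof.
move=> cu; apply: ub_le_sup; last by exists n.
have /cvg_seq_bounded[M [_ MP]] : cvgn u by apply: cvgP cu.
exists (M + 1) => _ [k _ <-]; apply: MP => //; lra.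
Qed.

Lemma sup_norm_le u (c : R) : (forall n, `|u n| <= c) -> sup_norm u <= c.
Proof. by move=> uc; apply: ge_sup => [|_ [n _ <-]//]; exists `|u 0%N|, 0%N. Qed.

End C0Sequences.

Lemma linear_subspace_sum (R : realType) (X : completeNormedModType R) (Y : set X)
    (I : Type) (r : seq I) (c : I -> R) (y : I -> X) :
  linear_subspace Y -> (forall i, Y (y i)) -> Y (\sum_(i <- r) c i *: y i).
Proof.
move=> [Y0 YP] Yy; elim: r => [|i r IHr]; first by rewrite big_nil.
by rewrite big_cons; exact: YP.
Qed.

(** The embedding sends [u] to the sum of the series of [u k *: y k]. The upper estimate makes this
    series Cauchy; both estimates then pass to the limit. *)
Lemma contains_c0_of_estimates (R : realType) (X : completeNormedModType R)
    (Y : set X) (y : nat -> X) (b C : R) :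
  closed Y -> linear_subspace Y -> (forall n, Y (y n)) -> 0 < b -> 0 < C ->
  (forall N (c : nat -> R) M, 0 <= M -> (forall k, (k < N)%N -> `|c k| <= M) ->
    `|\sum_(0 <= k < N) c k *: y k| <= C * M) ->
  (forall N (c : nat -> R) k, (k < N)%N ->
    (forall l, (l < N)%N -> `|c l| <= `|c k|) ->
    b * `|c k| <= `|\sum_(0 <= k < N) c k *: y k|) ->
  contains_c0 Y.
Proof.
move=> clY linY Yy b0 C0 upper lower.
pose S (u : nat -> R) := series (fun k => u k *: y k).
have cS u : c0 u -> cvgn (S u).
  move=> cu; apply: cauchy_cvg; apply/cauchy_seriesP => e e0.
  have [N NP] := c0_small cu (divr_gt0 e0 (mulr_gt0 (ltr0n _ 2) C0)).
  exists ([set n | (N <= n)%N], setT) => [|[m n] [/= Nm _]].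
    by split => //=; [exists N|exact: filterT].
  (* Zeroing the coefficients before [m] turns the tail sum into an initial one, to which [upper]
     applies. *)
  pose c k := if (m <= k)%N then u k else 0.
  have sumE : \sum_(m <= k < n) u k *: y k = \sum_(0 <= k < n) c k *: y k.
    have [mn|nm] := leqP m n; last first.
      rewrite big_geq ?(ltnW nm) // big_nat big1 // => k /= kn.
      by rewrite /c leqNgt (ltn_trans kn nm) scale0r.
    rewrite [RHS](big_cat_nat _ mn) //= -[LHS]add0r; congr (_ + _).
      rewrite big_nat big1 // => k /= km.
      by rewrite /c leqNgt km scale0r.
    by apply: eq_big_nat => k /andP[mk _]; rewrite /c mk.
  rewrite sumE; apply: (@le_lt_trans _ _ (C * (e / (2 * C)))).
    have e2C : 0 <= e / (2 * C) by rewrite divr_ge0 ?mulr_ge0 ?ltW.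
    apply: upper => // k _; rewrite /c; case: ifP => mk; last by rewrite normr0.
    by apply/ltW/NP; exact: leq_trans mk.
  suff -> : C * (e / (2 * C)) = e / 2 by lra.
  by field; rewrite gt_eqF.
have lower' u N k : c0 u -> (k < N)%N -> b * `|u k| <= `|S u N|.
  move=> cu kN.
  (* [lower] speaks of a coefficient of largest modulus only; such a coefficient dominates [u k]. *)
  have [l _ lP] := @arg_maxP _ _ 'I_N (Ordinal kN) xpredT (fun l => `|u l|) isT.
  apply: le_trans (lower N u l (ltn_ord l) _) => [|l' l'N].
    by rewrite ler_pM2l //; exact: lP (Ordinal kN) isT.
  exact: lP (Ordinal l'N) isT.
exists (fun u => limn (S u)); split=> [a u v cu cv|u cu|].
- have -> : S (fun n => a * u n + v n) = (fun n => a *: S u n + S v n).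
    apply/funext => n; rewrite /S /series /= scaler_sumr -big_split.
    by apply: eq_bigr => k _; rewrite scalerDl scalerA.
  apply: cvg_lim => //; apply: cvgD; last exact: cS.
  by apply: cvgZl_tmp; exact: cS.
- apply: (@closed_cvg _ _ _ _ (S u) Y clY _ _ (cS u cu)); apply: nearW => n.
  exact: linear_subspace_sum.
- exists b, C; split => // u cu; apply/andP; split.
    rewrite mulrC -ler_pdivlMr //; apply: sup_norm_le => n; rewrite ler_pdivlMr // mulrC.
    rewrite -lim_norm; last exact: cS.
    apply: limr_ge; first by apply: is_cvg_norm; exact: cS.
    by exists n.+1 => // N /= nN; exact: lower'.
  rewrite -lim_norm; last exact: cS.
  apply: limr_le; first by apply: is_cvg_norm; exact: cS.
  apply: nearW => N; apply: upper => [|k _]; last exact: le_sup_norm.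
  exact: le_trans (normr_ge0 _) (le_sup_norm 0 cu).
Qed.

(** * Finite-codimensional subspaces and the choice of sequences *)

Lemma infinite_dimensional_ker (R : realType) (X : completeNormedModType R)
    (Y : set X) (f : X -> R) :
  linear_subspace Y -> infinite_dimensional Y ->
  (forall a u v, f (a *: u + v) = a * f u + f v) ->
  linear_subspace (Y `&` [set y | f y = 0]) /\
  infinite_dimensional (Y `&` [set y | f y = 0]).
Proof.
move=> [Y0 YP] infY fP.
have f0 : f 0 = 0 by have := fP (- 1) 0 0; rewrite scaler0 addr0; lra.
split; first by split => // a u v [? fu] [? fv]; split; [exact: YP|rewrite /= fP fu fv; lra].
move=> [n [v [Zv Zspan]]]; apply: infY.
(* A finite spanning family of the kernel, enlarged by one [z] with [f z != 0], spans [Y], since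
   [y - (f y / f z) z] lies in the kernel. Without such [z] the kernel is all of [Y]. *)
have [[z [Yz fz]]|noz] := pselect (exists z, Y z /\ f z != 0); last first.
  exists n, v; split => [i|y Yy]; first by case: (Zv i).
  by apply: Zspan; split => //; apply: contrapT => /eqP fy; apply: noz; exists y.
exists n.+1, (fun i => oapp v z (unlift ord0 i)); split=> [i|y Yy].
  by case: unliftP => //= j _; case: (Zv j).
have [|c cE] := Zspan (- (f y / f z) *: z + y).
  by split; [exact: YP|rewrite /= fP; field].
exists (fun i => oapp c (f y / f z) (unlift ord0 i)).
rewrite big_ord_recl unlift_none /=; under eq_bigr => i _ do rewrite liftK /=.
by rewrite -cE scaleNr addrA subrr add0r.
Qed.

Lemma exists_unit_in_kers (R : realType) (X : completeNormedModType R) (Y : set X)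
    (I : choiceType) (f : I -> X -> R) (F : seq I) :
  linear_subspace Y -> infinite_dimensional Y ->
  (forall i a u v, f i (a *: u + v) = a * f i u + f i v) ->
  exists y, [/\ Y y, `|y| = 1 & forall i, i \in F -> f i y = 0].
Proof.
move=> linY infY fP; elim: F Y linY infY => [|i F IHF] Y linY infY; last first.
  have [linZ infZ] := infinite_dimensional_ker linY infY (fP i).
  have [y [[Yy fy] y1 yF]] := IHF _ linZ infZ.
  by exists y; split => // j; rewrite inE => /predU1P[->|/yF].
have [[y [Yy y0]]|noy] := pselect (exists y, Y y /\ y != 0).
  exists (`|y|^-1 *: y); split => //.
    by rewrite -[_ *: y]addr0; case: linY => ? YP; exact: YP.
  by rewrite normrZ normfV normr_id mulVf // normr_eq0.
exfalso; apply: infY; exists 0%N, (fun=> 0); split => [[]//|y Yy].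
exists (fun=> 0); rewrite big_ord0; apply: contrapT => /eqP y0.
by apply: noy; exists y.
Qed.

Lemma exists_summable (R : realType) (t : R) : 0 < t ->
  exists2 e : nat -> R, forall k, 0 < e k & forall N, \sum_(k < N) e k <= t.
Proof.
move=> t0; exists (fun k => t / 2 ^+ k.+1) => [k|N].
  by rewrite divr_gt0 ?exprn_gt0.
suff -> : \sum_(k < N) t / 2 ^+ k.+1 = t - t / 2 ^+ N.
  by rewrite gerBl divr_ge0 ?exprn_ge0 ?ltW.
elim: N => [|N IHN]; first by rewrite big_ord0 expr0 divr1 subrr.
rewrite big_ord_recr /= IHN exprS; field.
by rewrite expf_neq0.
Qed.

(** A choice depends on the past only through the union of the earlier supports, so it suffices to
    choose once for every pair [(n, F)] and to accumulate that union in [st]. *)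
Lemma exists_dependent_sequence (T : choiceType) (S : Type) (supp : S -> {fset T})
    (Q : nat -> {fset T} -> S -> Prop) :
  (forall n F, exists z, Q n F z) ->
  exists z : nat -> S, forall n, Q n (\bigcup_(w <- mkseq z n) supp w)%fset (z n).
Proof.
move=> exQ.
have /choice[G GP] : forall nF : nat * {fset T}, exists z, Q nF.1 nF.2 z.
  by move=> [n F]; exact: exQ.
pose st := fix st n : {fset T} :=
  if n is n'.+1 then (st n' `|` supp (G (n', st n')))%fset else fset0.
exists (fun n => G (n, st n)) => n.
suff -> : (\bigcup_(w <- mkseq (fun n => G (n, st n)) n) supp w)%fset = st n.
  exact: GP (n, st n).
elim: n => [|n IHn]; first by rewrite big_nil.
by rewrite mkseqS -cats1 big_cat big_seq1 IHn.
Qed.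

(** * Coordinate functionals and approximation in the completion *)

Section Completion.
Context (R : realType) (d : Order.disp_t) (W : orderType d).
Context (rho : W -> W -> nat) (sigma : seq (entry R nat) -> nat).
Context (X : completeNormedModType R) (J : {linear c00 R W -> X}).
Hypothesis X_completion : is_completion rho sigma J.
Implicit Types (x : c00 R W) (y : X) (Y : set X).

Let normJ x : `|J x| = norm_K rho sigma x.
Proof. exact: completion_isometric X_completion x. Qed.

Lemma mcoeff_le_normJ a x : `|mcoeff a x| <= `|J x|.
Proof. by rewrite normJ; exact: mcoeff_le_norm_K. Qed.

Lemma completion_approx y (e : R) : 0 < e -> exists x, `|y - J x| < e.
Proof.
move=> e0; have ye : (ball y e : set X) !=set0 by exists y; exact: ballxx.
have [z [yz [x _ xz]]] := completion_dense X_completion ye (ball_open y e).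
by exists x; rewrite xz; move: yz; rewrite -ball_normE.
Qed.

(** Coordinates are 1-Lipschitz for the norm, so they extend from the dense image of [J]; linearity
    is recovered by approximation. *)
Lemma completion_coordinates : exists f : W -> X -> R,
  (forall a y x, `|f a y - mcoeff a x| <= `|y - J x|) /\
  (forall a c u v, f a (c *: u + v) = c * f a u + f a v).
Proof.
(* [f a] must satisfy mcoeff a x - `|y - J x| <= f a y <= mcoeff a x + `|y - J x|
   for all [x]; the least such value is the supremum of the left-hand sides. *)
pose S a y := range (fun x => mcoeff a x - `|y - J x|).
have Sub a y x : ubound (S a y) (mcoeff a x + `|y - J x|).
  move=> _ [x' _ <-]; rewrite lerBlDr -addrA -lerBlDl -mcoeffB.
  apply: le_trans (ler_norm _) _; apply: le_trans (mcoeff_le_normJ _ _) _.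
  by rewrite linearB distrC (le_trans (ler_distD y _ _)) // (distrC (J x)).
pose f a y := sup (S a y).
have fP a y x : `|f a y - mcoeff a x| <= `|y - J x|.
  rewrite ler_distl; apply/andP; split.
    by apply: ub_le_sup; [exists (mcoeff a x + `|y - J x|); exact: Sub|exists x].
  by apply: ge_sup; [exists (mcoeff a x - `|y - J x|), x|exact: Sub].
exists f; split => // a c u v; apply/eqP; rewrite -subr_eq0 -normr_le0.
apply/ler_addgt0Pr => e e0; rewrite add0r.
(* The approximation error enters twice, once for [f a] at [c *: u + v] and once for [f a] at [u]
   and [v]; with this choice the total is [e]. *)
have e'0 : 0 < e / (2 * (`|c| + 1)) by rewrite divr_gt0 ?mulr_gt0 ?ltr_wpDl.
have [x ux] := completion_approx u e'0; have [x' vx'] := completion_approx v e'0.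
have := fP a (c *: u + v) (c *: x + x'); have := fP a u x; have := fP a v x'.
have -> : c *: u + v - J (c *: x + x') = c *: (u - J x) + (v - J x').
  by rewrite linearP opprD addrACA -scalerBr.
rewrite mcoeffD mcoeffZ => fv fu fuv.
have nuv : `|c *: (u - J x) + (v - J x')| <= `|c| * `|u - J x| + `|v - J x'|.
  by apply: le_trans (ler_normD _ _) _; rewrite normrZ.
have -> : f a (c *: u + v) - (c * f a u + f a v) =
    (f a (c *: u + v) - (c * mcoeff a x + mcoeff a x')) -
    (c * (f a u - mcoeff a x) + (f a v - mcoeff a x')) by ring.
apply: le_trans (ler_normB _ _) _.
apply: le_trans (lerD (le_trans fuv nuv) (ler_normD _ _)) _; rewrite normrM.
have cu : `|c| * `|f a u - mcoeff a x| <= `|c| * `|u - J x| by rewrite ler_wpM2l.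
have cu' : `|c| * `|u - J x| <= `|c| * (e / (2 * (`|c| + 1))).
  by rewrite ler_wpM2l // ltW.
have eE : e = 2 * (`|c| * (e / (2 * (`|c| + 1))) + e / (2 * (`|c| + 1))).
  by field; rewrite gt_eqF // ltr_wpDl.
lra.
Qed.

Lemma approx_sum (y : nat -> X) (x : nat -> c00 R W) (e : nat -> R) (t : R) :
  (forall k, `|y k - J (x k)| <= e k) -> (forall N, \sum_(k < N) e k <= t) ->
  forall N (c : nat -> R) M, 0 <= M -> (forall k, (k < N)%N -> `|c k| <= M) ->
  `|\sum_(0 <= k < N) c k *: y k - J (\sum_(k < N) c k *: x k)| <= M * t.
Proof.
move=> yx et N c M M0 cM.
rewrite big_mkord linear_sum -sumrB; apply: le_trans (ler_norm_sum _ _ _) _.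
apply: le_trans (ler_wpM2l M0 (et N)); rewrite mulr_sumr; apply: ler_sum => k _.
by rewrite linearZ -scalerBr normrZ; apply: ler_pM => //; exact: cM.
Qed.

(** * First case: unit vectors of arbitrarily small sup norm *)

Lemma contains_c0_of_small_sup Y : closed Y -> linear_subspace Y ->
  (forall e : R, 0 < e -> exists y x,
     [/\ Y y, `|y| = 1, `|y - J x| < e & forall a, `|mcoeff a x| <= e]) ->
  contains_c0 Y.
Proof.
move=> clY linY small.
(* A total perturbation of 1/16 gives norms at most 17/16 for the approximants, the upper constant
   11/8 + 1/16 = 23/16 and the lower constant 2 - 23/16 = 9/16. *)
have [|e e0 et] := @exists_summable R (1 / 16); first by lra.
have e_le k : e k <= 1 / 16.
  by apply: le_trans (et k.+1); rewrite big_ord_recr /= lerDr sumr_ge0 // => i _; rewrite ltW.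
pose Q n (F : {fset W}) (z : X * c00 R W) := [/\ Y z.1, `|z.1| = 1,
  `|z.1 - J z.2| <= e n & forall a, `|mcoeff a z.2| <= e n / (p_rho rho F).+1%:R].
have [n F|z zP] := @exists_dependent_sequence _ _ (fun z => msupp z.2) Q.
  have e'0 : 0 < e n / (p_rho rho F).+1%:R by rewrite divr_gt0.
  have [y [x [Yy y1 yx xa]]] := small _ e'0; exists (y, x); split => //.
  by apply: le_trans (ltW yx) _; rewrite ler_pdivrMr ?ltr0n // ler_peMr ?(ltW (e0 n)) // ler1n.
pose y n := (z n).1; pose x n := (z n).2.
have Yy n : Y (y n) by case: (zP n).
have y1 n : `|y n| = 1 by case: (zP n).
have yx n : `|y n - J (x n)| <= e n by case: (zP n).
have x_sup n a : `|mcoeff a (x n)| <= e n / (p_rho rho (supp_union (mkseq x n))).+1%:R.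
  have -> : supp_union (mkseq x n) = (\bigcup_(w <- mkseq z n) msupp w.2)%fset.
    by rewrite /supp_union /mkseq !big_map.
  by case: (zP n).
have x_norm n : norm_K rho sigma (x n) <= 17 / 16.
  have := ler_normB (y n) (y n - J (x n)); rewrite subKr y1 -normJ.
  by have := yx n; have := e_le n; lra.
have e_sum N : \sum_(k < N) e k <= 1 / 8 by apply: le_trans (et N) _; lra.
have upper N (c : nat -> R) M : 0 <= M -> (forall k, (k < N)%N -> `|c k| <= M) ->
    `|\sum_(0 <= k < N) c k *: y k| <= 23 / 16 * M.
  move=> M0 cM; have := approx_sum yx et M0 cM.
  have := norm_K_sum_le (fun k => ltW (e0 k)) x_norm x_sup e_sum M0 cM.
  rewrite -normJ; set v := \sum_(_ <= _ < _) _; set Jx := J _ => Jx_le vJx.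
  by have := ler_normD (v - Jx) Jx; rewrite subrK; lra.
apply: (@contains_c0_of_estimates _ _ _ y (9 / 16) (23 / 16)) => //; try lra.
move=> N c k kN ck.
(* These are the coefficients of the companion vector: adding it cancels every term but the one at
   [k], which is doubled. *)
pose c' l := if l == k then c k else - c l.
have := upper N c' `|c k| (normr_ge0 _).
have {}ck l : (l < N)%N -> `|c' l| <= `|c k|.
  by rewrite /c'; case: eqP => // _ /ck; rewrite normrN.
move=> /(_ ck).
have : \sum_(0 <= k < N) c k *: y k + \sum_(0 <= k < N) c' k *: y k = (2 * c k) *: y k.
  rewrite -big_split /= big_mkord (bigD1 (Ordinal kN)) //= big1 => [|l /negPf].
    by rewrite addr0 /c' eqxx -scalerDl; congr (_ *: _); ring.
  by rewrite -val_eqE /= /c' => ->; rewrite scaleNr subrr.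
set v := \sum_(_ <= _ < _) _; set v' := \sum_(_ <= _ < _) _ => vv' v'_le.
have := ler_normD v v'; rewrite vv' normrZ y1 mulr1 normrM normr_nat; lra.
Qed.

(** * Second case: sup norm equivalent to the norm on the subspace *)

Lemma contains_c0_of_large_sup Y (D : R) : closed Y -> linear_subspace Y ->
  infinite_dimensional Y -> 0 < D ->
  (forall y x, Y y -> `|y| = 1 -> `|y - J x| < D -> exists a, D < `|mcoeff a x|) ->
  contains_c0 Y.
Proof.
move=> clY linY infY D0 large.
have [f [fP f_lin]] := completion_coordinates.
have vanish (e : R) (F : {fset W}) : 0 < e -> exists y x,
    [/\ Y y, `|y| = 1, `|y - J x| <= e & forall a, a \in F -> mcoeff a x = 0].
  move=> e_gt0.
  have [y [Yy y1 yF]] := exists_unit_in_kers F linY infY f_lin.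
  have e'0 : 0 < e / (#|` F|.+1)%:R by rewrite divr_gt0.
  have [x yx] := completion_approx y e'0.
  (* As [f a y = 0] on [F], the coefficients of [x] there are at most [|y - J x|]. Deleting all of
     them costs at most [#|F|] times this error, hence the denominator [#|F| + 1]. *)
  pose r := \sum_(a <- F) mcoeff a x *: mkmalgU a (1 : R).
  exists y, (x - r); split => // [|a aF]; last first.
    rewrite mcoeffB raddf_sum /= (big_fsetD1 a) //= mcoeffZ mcoeffUU mulr1.
    rewrite big_seq big1 ?addr0 ?subrr // => b; rewrite !inE => /andP[ba _].
    by rewrite mcoeffZ mcoeffU (negPf ba) mulr0.
  have r_le : `|J r| <= #|` F|%:R * (e / (#|` F|.+1)%:R).
    move: yx; set e' := e / _ => yx.
    rewrite linear_sum; apply: le_trans (ler_norm_sum _ _ _) _.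
    rewrite mulr_natl -sum1_size -sumrMnr big_seq [leRHS]big_seq.
    apply: ler_sum => a /yF fa; rewrite linearZ normrZ mulr1n normJ.
    rewrite -[leRHS]mulr1; apply: ler_pM => //; last exact: norm_K_unit.
      by rewrite -normJ.
    apply: le_trans (ltW yx); apply: le_trans (fP a y x).
    by rewrite fa sub0r normrN.
  rewrite linearB opprB addrA addrAC; apply: le_trans (ler_normD _ _) _.
  have -> : e = e / (#|` F|.+1)%:R + #|` F|%:R * (e / (#|` F|.+1)%:R).
    rewrite -[X in X + _]mul1r -mulrDl -natr1 addrC; field.
    by rewrite natr1.
  by apply: lerD => //; exact: ltW.
(* The bound 1 keeps the approximants at norm at most 2; the bound [D / 4] keeps all perturbations
   within reach of [large]. *)
pose t := Num.min (D / 4) 1.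
have t0 : 0 < t by rewrite lt_min; lra.
have tD : t <= D / 4 by rewrite ge_min lexx.
have t1 : t <= 1 by rewrite ge_min lexx orbT.
have [e e0 et] := exists_summable t0.
have e_le k : e k <= t.
  by apply: le_trans (et k.+1); rewrite big_ord_recr /= lerDr sumr_ge0 // => i _; rewrite ltW.
pose Q n (F : {fset W}) (z : X * c00 R W) := [/\ Y z.1, `|z.1| = 1,
  `|z.1 - J z.2| <= e n & forall a, a \in F -> mcoeff a z.2 = 0].
have [n F|z zP] := @exists_dependent_sequence _ _ (fun z => msupp z.2) Q.
  by have [y [x ?]] := vanish (e n) F (e0 n); exists (y, x).
pose y n := (z n).1; pose x n := (z n).2.
have Yy n : Y (y n) by case: (zP n).
have y1 n : `|y n| = 1 by case: (zP n).
have yx n : `|y n - J (x n)| <= e n by case: (zP n).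
have x_disj k l a : mcoeff a (x k) != 0 -> l != k -> mcoeff a (x l) = 0.
  move=> ak; rewrite neq_ltn => /orP[lk|kl].
    have [_ _ _ zF] := zP k; apply/mcoeff_outdom; apply: contra ak => al.
    apply/eqP/zF/bigfcupP; exists (z l) => //; rewrite andbT.
    by rewrite map_f // mem_iota.
  have [_ _ _ zF] := zP l; apply: zF; apply/bigfcupP; exists (z k).
    by rewrite andbT map_f // mem_iota.
  by rewrite -mcoeff_neq0.
have sum_coeff N (c : nat -> R) k a : (k < N)%N -> mcoeff a (x k) != 0 ->
    mcoeff a (\sum_(k < N) c k *: x k) = c k * mcoeff a (x k).
  move=> kN ak; rewrite raddf_sum /= (bigD1 (Ordinal kN)) //= mcoeffZ big1 ?addr0 //.
  by move=> l lk; rewrite mcoeffZ (x_disj k l) ?mulr0.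
have x_le2 k a : `|mcoeff a (x k)| <= 2.
  apply: le_trans (mcoeff_le_normJ _ _) _.
  by have := ler_normB (y k) (y k - J (x k)); rewrite subKr y1;
    have := yx k; have := e_le k; lra.
apply: (@contains_c0_of_estimates _ _ _ y (D / 2) (1 + 2 / D)) => //.
- by rewrite divr_gt0.
- by rewrite addr_gt0 ?divr_gt0.
- move=> N c M M0 cM; have := approx_sum yx et M0 cM.
  set v := \sum_(_ <= _ < _) _; set u := \sum_(_ < _) _ => vu.
  have Yv : Y v by exact: linear_subspace_sum.
  have [vM|Mv] := leP `|v| M.
    by apply: le_trans vM _; rewrite mulrDl mul1r lerDl mulr_ge0 // divr_ge0 // ltW.
  have v0 : 0 < `|v| by exact: le_lt_trans Mv.
  (* If [|v| > M], normalizing yields a coordinate where [|u|] exceeds [D * |v|]. Disjoint supports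
     bound every coordinate of [u] by [2 * M], so [|v|] is at most [2 / D * M]. *)
  have [||| a] := large (`|v|^-1 *: v) (`|v|^-1 *: u).
  + by rewrite -[_ *: v]addr0; case: linY => ? YP; exact: YP.
  + by rewrite normrZ normfV normr_id mulVf // gt_eqF.
  + rewrite linearZ -scalerBr normrZ normfV normr_id mulrC ltr_pdivrMr //.
    have Mt : M * t <= M * (D / 4) by rewrite ler_wpM2l.
    have : D * M < D * `|v| by rewrite ltr_pM2l.
    have := mulr_ge0 (ltW D0) M0; lra.
  rewrite mcoeffZ normrM normfV normr_id mulrC ltr_pdivlMr // => Dv.
  have ua : `|mcoeff a u| <= 2 * M.
    have [/existsP[k ak]|] := boolP [exists k : 'I_N, mcoeff a (x k) != 0].
      rewrite /u (sum_coeff _ _ k) // normrM mulrC; apply: ler_pM => //; exact: cM.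
    rewrite negb_exists => /forallP xa.
    rewrite /u raddf_sum /= big1 ?normr0 ?mulr_ge0 // => k _.
    by have := xa k; rewrite negbK mcoeffZ => /eqP->; rewrite mulr0.
  have : `|v| <= 2 / D * M.
    by rewrite mulrAC ler_pdivlMr // mulrC (le_trans (ltW Dv)).
  lra.
- move=> N c k kN ck; have := approx_sum yx et (normr_ge0 (c k)) ck.
  set v := \sum_(_ <= _ < _) _; set u := \sum_(_ < _) _ => vu.
  (* At this coordinate [u] equals [c k] times a number of modulus above [D], so [|J u|] is at least
     [D * |c k|]; passing to [v] loses at most a quarter of that. *)
  have [|a Da] := large (y k) (x k) (Yy k) (y1 k).
    by apply: le_lt_trans (yx k) _; have := e_le k; lra.
  have := mcoeff_le_normJ a u; rewrite /u (sum_coeff _ _ k) //; last first.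
    by rewrite -normr_gt0 (lt_trans D0).
  rewrite -/u normrM => cu.
  have cD : `|c k| * D <= `|c k| * `|mcoeff a (x k)| by rewrite ler_wpM2l // ltW.
  have ct : `|c k| * t <= `|c k| * (D / 4) by rewrite ler_wpM2l.
  have := ler_normB v (v - J u); rewrite subKr.
  have := mulr_ge0 (normr_ge0 (c k)) (ltW D0).
  lra.
Qed.

End Completion.

Theorem theorem3p2 (R : realType) (d : Order.disp_t) (W : orderType d)
  (W_omega1 : is_omega1 W)
  (rho : W -> W -> nat) (rhoP : rho_function rho)
  (sigma : seq (entry R nat) -> nat) (sigmaP : coding sigma)
  (X : completeNormedModType R) (J : {linear c00 R W -> X})
  (X_completion : is_completion rho sigma J) :
  c0_saturated X.
Proof.
move=> Y clY linY infY.
have [small|nsmall] := pselect (forall e : R, 0 < e -> exists y x,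
  [/\ Y y, `|y| = 1, `|y - J x| < e & forall a, `|mcoeff a x| <= e]).
  exact: contains_c0_of_small_sup X_completion _ clY linY small.
(* An [e] at which [small] fails serves as [D], both as approximation distance and as lower bound on
   the sup norm. *)
have [D [D0 large]] : exists D : R, 0 < D /\ forall y x, Y y -> `|y| = 1 ->
    `|y - J x| < D -> exists a, D < `|mcoeff a x|.
  apply: contrapT => nlarge; apply: nsmall => e e0.
  apply: contrapT => nex; apply: nlarge; exists e; split => // y x Yy y1 yx.
  apply: contrapT => na; apply: nex; exists y, x; split => // a.
  by rewrite leNgt; apply/negP => ea; apply: na; exists a.
exact: contains_c0_of_large_sup X_completion _ _ clY linY infY D0 large.
Qed.
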